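(* Let $n,d$ be non-negative integers. Let $f:R\to S$ be a surjective ring homomorphism such that $S$ is projective both as a right $R$-module $S_R$ and as a left $R$-module ${}_RS$ (via $f$), and let $G$ be a right $S$-module. Then the following statements are equivalent: (1) $G$, regarded as a right $R$-module $G_R$ via $f$, is Gorenstein $(n,d)$-flat; (2) the right $S$-module $G\otimes_R S$ is Gorenstein $(n,d)$-flat; (3) the right $S$-module $G_S$ is Gorenstein $(n,d)$-flat.
   Context: Rings are associative with non-zero identity and modules are unitary. The following definitions are over an arbitrary ring $T$. A left $T$-module $U$ is $n$-presented if there is an exact sequence $F_n\to F_{n-1}\to\cdots\to F_1\to F_0\to U\to 0$ of left $T$-modules with each $F_i$ finitely generated free. For a right module $M$ and a left module $U$, $\mathrm{Tor}_k^T(U,M)$ denotes the $k$-th Tor group of the pair, i.e. of $M\otimes_T U$. A right $T$-module $M$ is $(n,d)$-flat if $\mathrm{Tor}_{d+1}^T(U,M)=0$ for every $n$-presented left $T$-module $U$. A right $T$-module $G$ is Gorenstein $(n,d)$-flat if there is an exact sequence $\mathbf{F}=\cdots\to F_1\to F_0\to F^0\to F^1\to\cdots$ of $(n,d)$-flat right $T$-modules with $G=\ker(F^0\to F^1)$ such that the complex $\mathrm{Tor}_d^T(U,\mathbf{F})$ (obtained by applying $\mathrm{Tor}_d^T(U,-)$ to $\mathbf F$) is exact for every $n$-presented left $T$-module $U$ with finite flat dimension $\mathrm{fd}_T(U)<\infty$. *)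

(* Defs.v *)
(* A right T-module is a left module over the converse ring of T, so for
   t : T, the element (t : op T) *: m is the product m.t *)
From HB Require Import structures.
From mathcomp Require Import all_boot all_algebra.
From mathcomp Require Import generic_quotient ring_quotient.
From mathcomp.classical Require Import boolp.
From mathcomp.multinomials Require Import freeg.
Set Implicit Arguments.
Unset Strict Implicit.
Unset Printing Implicit Defensive.
Import GRing.Theory.
Local Open Scope ring_scope.
Local Open Scope quotient_scope.

Definition op (T : nzRingType) : nzRingType := T^c.

Definition surj (A B : Type) (f : A -> B) : Prop := forall y, exists x, f x = y.

Definition exact (A B C : zmodType) (f : A -> B) (g : B -> C) : Prop :=
  forall y, g y = 0 <-> exists x, f x = y.

(* quo N is the quotient of V by the subgroup generated by N. *)
Inductive span (V : zmodType) (N : V -> Prop) : V -> Prop :=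
| span0 : span N 0
| span_in x : N x -> span N x
| spanB x y : span N x -> span N y -> span N (x - y).

Definition spanb (V : zmodType) (N : V -> Prop) : {pred V} :=
  fun x => `[< span N x >].

Lemma spanb_closed (V : zmodType) (N : V -> Prop) : zmod_closed (spanb N).
Proof.
split=> [|x y /asboolP Nx /asboolP Ny]; apply/asboolP; first exact: span0.
exact: spanB.
Qed.

HB.instance Definition _ (V : zmodType) (N : V -> Prop) :=
  GRing.isZmodClosed.Build V (spanb N) (spanb_closed N).

Definition quo (V : zmodType) (N : V -> Prop) : zmodType :=
  Quotient.quot (spanb N).

Definition quo_pi (V : zmodType) (N : V -> Prop) (x : V) : quo N :=
  \pi_(Quotient.quot (spanb N)) x.

Lemma quo_piP (V : zmodType) (N : V -> Prop) (x y : V) :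
  quo_pi N x = quo_pi N y <-> span N (x - y).
Proof.
rewrite /quo_pi; split=> [/eqP|H].
  by rewrite -Quotient.idealrBE => /asboolP.
by apply/eqP; rewrite -Quotient.idealrBE; apply/asboolP.
Qed.

Lemma quo_pi_is_zmod_morphism (V : zmodType) (N : V -> Prop) :
  zmod_morphism (quo_pi N).
Proof. by move=> x y; rewrite /quo_pi raddfB. Qed.

HB.instance Definition _ (V : zmodType) (N : V -> Prop) :=
  GRing.isZmodMorphism.Build V (quo N) (quo_pi N) (@quo_pi_is_zmod_morphism V N).

Definition quo_repr (V : zmodType) (N : V -> Prop) (q : quo N) : V :=
  repr (q : Quotient.quot (spanb N)).

Lemma quo_reprK (V : zmodType) (N : V -> Prop) (q : quo N) :
  quo_pi N (quo_repr q) = q.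
Proof. exact: reprK. Qed.

Section QuoLift.
Variables (V W : zmodType) (N : V -> Prop) (g : {additive V -> W}).
Hypothesis gN : forall x, N x -> g x = 0.

Definition quo_lift of (forall x, N x -> g x = 0) : quo N -> W :=
  fun q => g (quo_repr q).

Lemma span_ker x : span N x -> g x = 0.
Proof.
by elim=> [|y /gN //|y z _ gy _ gz]; rewrite ?raddf0 // raddfB gy gz subr0.
Qed.

Lemma quo_lift_pi x : quo_lift gN (quo_pi N x) = g x.
Proof.
apply/eqP; rewrite -subr_eq0 -raddfB; apply/eqP/span_ker/quo_piP.
exact: quo_reprK.
Qed.

Lemma quo_lift_is_zmod_morphism : zmod_morphism (quo_lift gN).
Proof.
move=> x y; rewrite -[x]quo_reprK -[y]quo_reprK -raddfB.
by rewrite !quo_lift_pi raddfB.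
Qed.

HB.instance Definition _ :=
  GRing.isZmodMorphism.Build (quo N) W (quo_lift gN) quo_lift_is_zmod_morphism.
End QuoLift.

Record chain_complex := ChainComplex {
  chain :> nat -> zmodType;
  bd : forall k, {additive chain k.+1 -> chain k};
  bdK : forall k x, bd k (bd k.+1 x) = 0 }.

Record chain_map (C D : chain_complex) := ChainMap {
  chain_fun :> forall k, {additive C k -> D k};
  chain_funP : forall k x, bd D k (chain_fun k.+1 x) = chain_fun k (bd C k x) }.

Definition is_cycle (C : chain_complex) (k : nat) : pred (C k) :=
  match k return pred (C k) with
  | 0 => predT
  | j.+1 => fun x => bd C j x == 0
  end.
Arguments is_cycle : clear implicits.

Record cycles (C : chain_complex) (k : nat) :=
  Cycle { cycle_val : C k; _ : is_cycle C k cycle_val }.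

HB.instance Definition _ (C : chain_complex) (k : nat) :=
  [isSub for @cycle_val C k].
HB.instance Definition _ (C : chain_complex) (k : nat) :=
  [Choice of cycles C k by <:].

Lemma is_cycle_closed (C : chain_complex) (k : nat) :
  zmod_closed (is_cycle C k).
Proof.
case: k => [|k]; first by split.
split=> [|x y]; first by apply/eqP; rewrite raddf0.
by move=> /eqP dx /eqP dy; apply/eqP; rewrite raddfB dx dy subr0.
Qed.

HB.instance Definition _ (C : chain_complex) (k : nat) :=
  GRing.SubChoice_isSubZmodule.Build (C k) (is_cycle C k) (cycles C k)
    (is_cycle_closed C k).

Definition is_boundary (C : chain_complex) (k : nat) (z : cycles C k) : Prop :=
  exists x, bd C k x = val z.

Definition homology (C : chain_complex) (k : nat) : zmodType :=
  quo (@is_boundary C k).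

Section HomologyMap.
Variables (C D : chain_complex) (h : chain_map C D) (k : nat).

Lemma chain_fun_cycle (z : cycles C k) : is_cycle D k (h k (val z)).
Proof.
case: k z => [|j] z //=; rewrite chain_funP.
by have /eqP -> := valP z; rewrite raddf0.
Qed.

Definition cycles_map (z : cycles C k) : cycles D k := Cycle (chain_fun_cycle z).

Lemma cycles_map_is_zmod_morphism : zmod_morphism cycles_map.
Proof. by move=> x y; apply/val_inj; rewrite /= !raddfB. Qed.

HB.instance Definition _ :=
  GRing.isZmodMorphism.Build (cycles C k) (cycles D k) cycles_map
    cycles_map_is_zmod_morphism.

Definition cycles_class : {additive cycles C k -> homology D k} :=
  quo_pi (@is_boundary D k) \o cycles_map.

Lemma cycles_class_boundary z : is_boundary z -> cycles_class z = 0.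
Proof.
move=> [x dx]; rewrite -(raddf0 (quo_pi (@is_boundary D k))) /=.
apply/quo_piP; rewrite subr0; apply: span_in; exists (h k.+1 x).
by rewrite chain_funP dx.
Qed.

Definition homology_map : {additive homology C k -> homology D k} :=
  quo_lift cycles_class_boundary.
End HomologyMap.

Section Tensor.
Variables (T : nzRingType) (M : lmodType (op T)) (U : lmodType T).

Inductive tens_rel : {freeg (M * U)%type / int} -> Prop :=
| tens_relDl m m' u : tens_rel (<< (m + m', u) >> - << (m, u) >> - << (m', u) >>)
| tens_relDr m u u' : tens_rel (<< (m, u + u') >> - << (m, u) >> - << (m, u') >>)
| tens_relZ (t : T) m u :
    tens_rel (<< ((t : op T) *: m, u) >> - << (m, t *: u) >>).

Definition tens : zmodType := quo tens_rel.

Definition pure (m : M) (u : U) : tens := quo_pi tens_rel << (m, u) >>.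

Record balanced (A : zmodType) (b : M -> U -> A) : Prop := Balanced {
  balancedDl : forall m m' u, b (m + m') u = b m u + b m' u;
  balancedDr : forall m u u', b m (u + u') = b m u + b m u';
  balancedZ : forall (t : T) m u, b ((t : op T) *: m) u = b m (t *: u) }.

Lemma pure_balanced : balanced pure.
Proof.
have rel0 x : tens_rel x -> quo_pi tens_rel x = 0.
  move=> rx; rewrite -(raddf0 (quo_pi tens_rel)).
  by apply/quo_piP; rewrite subr0; exact: span_in.
split=> [m m' u|m u u'|t m u].
- apply/eqP; rewrite -subr_eq0 opprD addrA; apply/eqP.
  by rewrite /pure -2!(raddfB (quo_pi tens_rel)); apply: rel0; exact: tens_relDl.
- apply/eqP; rewrite -subr_eq0 opprD addrA; apply/eqP.
  by rewrite /pure -2!(raddfB (quo_pi tens_rel)); apply: rel0; exact: tens_relDr.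
- apply/eqP; rewrite -subr_eq0; apply/eqP.
  by rewrite /pure -(raddfB (quo_pi tens_rel)); apply: rel0; exact: tens_relZ.
Qed.

Lemma tens_ind (P : tens -> Prop) :
    P 0 -> (forall m u, P (pure m u)) -> (forall x y, P x -> P y -> P (x - y)) ->
  forall x, P x.
Proof.
move=> P0 Pp PB x.
have PN y : P y -> P (- y) by rewrite -sub0r; exact: PB.
have PD y z : P y -> P z -> P (y + z).
  by move=> Py Pz; rewrite -[z]opprK; apply: PB => //; exact: PN.
rewrite -[x]quo_reprK; elim/freeg_ind_dom0: (quo_repr x) => [|c [m u] D _ _ IH].
  by rewrite raddf0.
rewrite raddfD; apply/PD => //.
have -> : << c *g (m, u) >> = << (m, u) >> *~ c :> {freeg (M * U)%type / int}.
  by apply/eqP/freeg_eqP => z; rewrite -scaler_int coeffZ !coeffU mul1r intz.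
have Pn k : P (pure m u *+ k).
  by elim: k => [|k IHk]; rewrite ?mulr0n // mulrS; apply/PD.
rewrite raddfMz; case: c => c; first by rewrite -pmulrn; exact: Pn.
by rewrite NegzE mulrNz; apply/PN; rewrite -pmulrn; exact: Pn.
Qed.

End Tensor.

Section TensorLift.
Variables (T : nzRingType) (M : lmodType (op T)) (U : lmodType T) (A : zmodType).
Variable b : M -> U -> A.

Definition tens_lift_free : {freeg (M * U)%type / int} -> A :=
  fglift (fun p => b p.1 p.2 : zmodule A).

Lemma tens_lift_free_is_zmod_morphism : zmod_morphism tens_lift_free.
Proof.
exact: (@lift_is_additive int (M * U)%type (zmodule A) (fun p => b p.1 p.2)).
Qed.

HB.instance Definition _ :=
  GRing.isZmodMorphism.Build {freeg (M * U)%type / int} A tens_lift_free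
    tens_lift_free_is_zmod_morphism.

Lemma tens_lift_free1 p : tens_lift_free << p >> = b p.1 p.2.
Proof. by rewrite /tens_lift_free liftU scale1r. Qed.

Lemma tens_lift_free_rel : balanced b ->
  forall x, tens_rel x -> tens_lift_free x = 0.
Proof.
case=> bDl bDr bZ x; case=> *; rewrite !raddfB /= !tens_lift_free1 /=.
- by rewrite bDl addrAC addrK subrr.
- by rewrite bDr addrAC addrK subrr.
- by rewrite bZ subrr.
Qed.

Definition tens_lift (hb : balanced b) : {additive tens M U -> A} :=
  quo_lift (tens_lift_free_rel hb).

Lemma tens_lift_pure (hb : balanced b) m u : tens_lift hb (pure m u) = b m u.
Proof.
exact: etrans (quo_lift_pi (tens_lift_free_rel hb) _) (tens_lift_free1 _).
Qed.
End TensorLift.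
Arguments tens_lift : simpl never.

Section TensorMap.
Variables (T : nzRingType) (M M' : lmodType (op T)) (U U' : lmodType T).
Variables (phi : {linear M -> M'}) (psi : {linear U -> U'}).

Lemma tens_map_balanced : balanced (fun m u => pure (phi m) (psi u)).
Proof.
have [pDl pDr pZ] := pure_balanced M' U'.
by split=> *; rewrite ?raddfD ?linearZ ?pDl ?pDr ?pZ.
Qed.

Definition tens_map : {additive tens M U -> tens M' U'} :=
  tens_lift tens_map_balanced.

Lemma tens_map_pure m u : tens_map (pure m u) = pure (phi m) (psi u).
Proof. exact: tens_lift_pure. Qed.
End TensorMap.
Arguments tens_map : simpl never.

Lemma tens_ext (T : nzRingType) (M : lmodType (op T)) (U : lmodType T)
    (A : zmodType) (g h : {additive tens M U -> A}) :
  (forall m u, g (pure m u) = h (pure m u)) -> g =1 h.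
Proof.
move=> gh; apply: tens_ind => [|//|x y gx gy]; first by rewrite !raddf0.
by rewrite !raddfB gx gy.
Qed.

Section FreeCover.
Variables (T : nzRingType) (U : lmodType T).

Local Notation free_on := {freeg U / T}.

Definition free_eval : free_on -> U := fglift (fun u : U => u).

Lemma free_eval_is_zmod_morphism : zmod_morphism free_eval.
Proof. exact: (@lift_is_additive T U U (fun u => u)). Qed.

HB.instance Definition _ :=
  GRing.isZmodMorphism.Build free_on U free_eval free_eval_is_zmod_morphism.

Lemma free_eval1 c u : free_eval << c *g u >> = c *: u.
Proof. exact: liftU. Qed.

Lemma free_eval_is_scalable : scalable free_eval.
Proof.
move=> c; elim/freeg_ind_dom0 => [|k x D _ _ IH].
  by rewrite scaler0 raddf0 scaler0.
have cE : c *: << k *g x >> = << c * k *g x >> :> free_on.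
  by apply/eqP/freeg_eqP => z; rewrite coeffZ !coeffU mulrA.
by rewrite scalerDr cE !raddfD /= IH !free_eval1 scalerA.
Qed.

HB.instance Definition _ :=
  GRing.isScalable.Build T free_on U *:%R free_eval free_eval_is_scalable.

Definition free_relation : pred free_on := fun x => free_eval x == 0.

Record syzygy_of := Syzygy { syzygy_val : free_on; _ : free_relation syzygy_val }.

HB.instance Definition _ := [isSub for syzygy_val].
HB.instance Definition _ := [Choice of syzygy_of by <:].

Lemma free_relation_closed : subsemimod_closed free_relation.
Proof.
split=> [|c x /eqP x0]; last by apply/eqP; rewrite linearZ /= x0 scaler0.
split=> [|x y /eqP x0 /eqP y0]; apply/eqP; first exact: raddf0.
by rewrite raddfD /= x0 y0 addr0.
Qed.

HB.instance Definition _ :=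
  GRing.SubChoice_isSubLmodule.Build T free_on free_relation syzygy_of
    free_relation_closed.

Definition syzygy : lmodType T := syzygy_of.

Definition syzygy_incl : {linear syzygy -> ({freeg U / T} : lmodType T)} := val.
End FreeCover.

(* A sequence ... -> P_1 -> P_0 -> U of modules and maps; no complex condition. *)
Record augmented (T : nzRingType) (U : lmodType T) := Augmented {
  aobj :> nat -> lmodType T;
  abd : forall k, {linear aobj k.+1 -> aobj k};
  aug : {linear aobj 0%N -> U} }.

Definition exact_at (T : nzRingType) (U : lmodType T) (P : augmented U)
    (k : nat) : Prop :=
  match k with
  | 0 => exact (abd P 0) (aug P)
  | j.+1 => exact (abd P j.+1) (abd P j)
  end.

Section Resolution.
Variables (T : nzRingType) (U : lmodType T).

Definition syz (k : nat) : lmodType T := iter k (@syzygy T) U.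

Definition free_res : augmented U :=
  @Augmented T U (fun k => {freeg (syz k) / T})
    (fun k => syzygy_incl (syz k) \o @free_eval T (syz k.+1))
    (@free_eval T U).

Lemma free_resK k (x : free_res k.+2) :
  abd free_res k (abd free_res k.+1 x) = 0.
Proof.
rewrite /=; have /eqP -> := valP (free_eval x).
exact: (raddf0 (syzygy_incl (syz k))).
Qed.
End Resolution.

(* Tor U M k is Tor_k(U, M) = H_k(M (x) P), where P = free_res U is the free
   resolution in which P_0 is free on the set U and P_(k+1) is free on the set
   of elements of the kernel of P_k -> P_(k-1) (of P_0 -> U if k = 0). *)
Section Tor.
Variables (T : nzRingType) (U : lmodType T).

Section TensorComplex.
Variable M : lmodType (op T).

Definition tens_bd (k : nat) :
    {additive tens M (free_res U k.+1) -> tens M (free_res U k)} :=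
  tens_map idfun (abd (free_res U) k).

Lemma tens_bdK k x : tens_bd k (tens_bd k.+1 x) = 0.
Proof.
elim/tens_ind: x => [|m p|x y dx dy]; first by rewrite !raddf0.
  rewrite /tens_bd !tens_map_pure free_resK.
  by apply: (addrI (pure m 0)); rewrite -(balancedDr (pure_balanced _ _)) !addr0.
by rewrite !raddfB dx dy subr0.
Qed.

Definition tens_complex : chain_complex := ChainComplex tens_bdK.

Definition Tor (k : nat) : zmodType := homology tens_complex k.
End TensorComplex.

Variables (M M' : lmodType (op T)) (phi : {linear M -> M'}).

Definition tens_chain_fun (k : nat) :
    {additive tens_complex M k -> tens_complex M' k} :=
  tens_map phi idfun.

Lemma tens_chain_funP k x :
  bd (tens_complex M') k (tens_chain_fun k.+1 x) =
  tens_chain_fun k (bd (tens_complex M) k x).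
Proof.
elim/tens_ind: x => [|m p|x y dx dy]; first by rewrite !raddf0.
  have bdE (N : lmodType (op T)) (n : N) q : bd (tens_complex N) k (pure n q) =
      pure n (abd (free_res U) k q).
    exact: tens_map_pure.
  have funE j q : tens_chain_fun j (pure m q) = pure (phi m) q.
    exact: tens_map_pure.
  by rewrite bdE !funE; exact: bdE.
by rewrite !raddfB dx dy.
Qed.

Definition Tor_map (k : nat) : {additive Tor M k -> Tor M' k} :=
  homology_map (ChainMap tens_chain_funP) k.
End Tor.

Definition projective (T : nzRingType) (P : lmodType T) : Prop :=
  forall (A B : lmodType T) (g : {linear A -> B}) (h : {linear P -> B}),
    surj g -> exists k : {linear P -> A}, forall x, g (k x) = h x.

Definition flat (T : nzRingType) (U : lmodType T) : Prop :=
  forall (M M' : lmodType (op T)) (phi : {linear M -> M'}),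
    injective phi -> injective (tens_map phi (idfun : {linear U -> U})).

Definition fg_free (T : nzRingType) (F : lmodType T) : Prop :=
  exists (m : nat) (phi : {linear F -> 'rV[T]_m}), bijective phi.

(* Only P_0, ..., P_n and the maps between them are constrained. *)
Definition n_presented (n : nat) (T : nzRingType) (U : lmodType T) : Prop :=
  exists P : augmented U,
    [/\ surj (aug P),
        forall k, (k < n)%N -> exact_at P k
      & forall k, (k <= n)%N -> fg_free (P k)].

Definition finite_fd (T : nzRingType) (U : lmodType T) : Prop :=
  exists (m : nat) (P : augmented U),
    [/\ surj (aug P),
        forall k, exact_at P k,
        forall k, flat (P k)
      & forall k, (m < k)%N -> forall x : P k, x = 0].

Definition nd_flat (n d : nat) (T : nzRingType) (M : lmodType (op T)) : Prop :=
  forall U : lmodType T, n_presented n U -> forall x : Tor U M d.+1, x = 0.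

(* The sequence is indexed by int: F^i is F i and F_i is F (-1 - i). *)
Definition gorenstein_flat (n d : nat) (T : nzRingType) (G : lmodType (op T)) : Prop :=
  exists (F : int -> lmodType (op T)) (del : forall i, {linear F i -> F (i + 1)}),
    [/\ forall i, nd_flat n d (F i),
        forall i, exact (del i) (del (i + 1)),
        exists j : {linear G -> F 0}, injective j /\ exact j (del 0)
      & forall U : lmodType T, n_presented n U -> finite_fd U ->
          forall i, exact (Tor_map U (del i) d) (Tor_map U (del (i + 1)) d)].

Section ConverseMorphism.
Variables (R S : nzRingType) (f : {rmorphism R -> S}).

Definition conv_fun : op R -> op S := f.

Lemma conv_fun_is_zmod_morphism : zmod_morphism conv_fun.
Proof. exact: (raddfB f). Qed.

Lemma conv_fun_is_monoid_morphism : monoid_morphism conv_fun.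
Proof. by split=> [|x y]; [exact: (rmorph1 f) | exact: (rmorphM f y x)]. Qed.

HB.instance Definition _ :=
  GRing.isZmodMorphism.Build (op R) (op S) conv_fun conv_fun_is_zmod_morphism.
HB.instance Definition _ :=
  GRing.isMonoidMorphism.Build (op R) (op S) conv_fun conv_fun_is_monoid_morphism.

Definition conv : {rmorphism op R -> op S} := conv_fun.
End ConverseMorphism.

(* A B-module viewed as an A-module through f : A -> B *)
Definition restrict_type (A B : nzRingType) (f : {rmorphism A -> B})
  (V : lmodType B) : Type := V.

Section Restrict.
Variables (A B : nzRingType) (f : {rmorphism A -> B}) (V : lmodType B).
Local Notation W := (restrict_type f V).

HB.instance Definition _ := GRing.Zmodule.on W.

Definition restrict_scale (a : A) (v : W) : W := f a *: (v : V).

Lemma restrict_scaleA a b v :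
  restrict_scale a (restrict_scale b v) = restrict_scale (a * b) v.
Proof. by rewrite /restrict_scale scalerA rmorphM. Qed.

Lemma restrict_scale1 : left_id 1 restrict_scale.
Proof. by move=> v; rewrite /restrict_scale rmorph1 scale1r. Qed.

Lemma restrict_scaleDr : right_distributive restrict_scale +%R.
Proof. by move=> a u v; exact: (scalerDr (f a) (u : V) v). Qed.

Lemma restrict_scaleDl v : {morph restrict_scale^~ v : a b / a + b}.
Proof. by move=> a b; rewrite /restrict_scale rmorphD; exact: scalerDl. Qed.

HB.instance Definition _ :=
  GRing.Zmodule_isLmodule.Build A W
    restrict_scaleA restrict_scale1 restrict_scaleDr restrict_scaleDl.

Definition restrict : lmodType A := W.
End Restrict.

(* The right S-module M (x)_R S, with (m (x) s).s' = m (x) s s' *)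
Section Extend.
Variables (R S : nzRingType) (f : {rmorphism R -> S}) (M : lmodType (op R)).

Definition left_reg : lmodType R := restrict f S^o.

Definition right_mul (s : S) (x : left_reg) : left_reg := (x : S) * s.

Lemma right_mul_is_zmod_morphism s : zmod_morphism (right_mul s).
Proof. by move=> x y; exact: mulrBl. Qed.

Lemma right_mul_is_scalable s : scalable (right_mul s).
Proof. by move=> a x; exact: esym (mulrA _ _ _). Qed.

HB.instance Definition _ (s : S) :=
  GRing.isZmodMorphism.Build left_reg left_reg (right_mul s)
    (right_mul_is_zmod_morphism s).
HB.instance Definition _ (s : S) :=
  GRing.isScalable.Build R left_reg left_reg *:%R (right_mul s)
    (right_mul_is_scalable s).

Definition extend_type : Type := tens M left_reg.

HB.instance Definition _ := GRing.Zmodule.on extend_type.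

Definition extend_scale (s : op S) (x : extend_type) : extend_type :=
  tens_map (idfun : {linear M -> M}) (right_mul s) x.

Lemma extend_scale_pure (s : S) m x :
  extend_scale s (pure m x) = pure m (right_mul s x).
Proof. exact: tens_map_pure. Qed.

Lemma extend_scaleB (s : S) x y :
  extend_scale s (x - y) = extend_scale s x - extend_scale s y.
Proof. exact: raddfB. Qed.

Lemma extend_scale0 (s : S) : extend_scale s 0 = 0.
Proof. exact: raddf0. Qed.

Lemma extend_scaleA (a b : op S) x :
  extend_scale a (extend_scale b x) = extend_scale (a * b) x.
Proof.
elim/tens_ind: x => [|m p|x y IHx IHy]; first by rewrite !extend_scale0.
  by rewrite !extend_scale_pure /right_mul -mulrA.
by rewrite !extend_scaleB IHx IHy.
Qed.

Lemma extend_scale1 : left_id 1 extend_scale.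
Proof.
elim/tens_ind => [|m p|x y IHx IHy]; first exact: extend_scale0.
  by rewrite extend_scale_pure /right_mul mulr1.
by rewrite extend_scaleB IHx IHy.
Qed.

Lemma extend_scaleDr : right_distributive extend_scale +%R.
Proof. by move=> s x y; exact: raddfD. Qed.

Lemma extend_scaleDl x : {morph extend_scale^~ x : a b / a + b}.
Proof.
move=> a b; elim/tens_ind: x => [|m p|x y IHx IHy].
- by rewrite !extend_scale0 addr0.
- rewrite !extend_scale_pure /right_mul mulrDr.
  exact: (balancedDr (pure_balanced M left_reg)).
- by rewrite !extend_scaleB IHx IHy opprD addrACA.
Qed.

HB.instance Definition _ :=
  GRing.Zmodule_isLmodule.Build (op S) extend_type
    extend_scaleA extend_scale1 extend_scaleDr extend_scaleDl.

Definition extend : lmodType (op S) := extend_type.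
End Extend.

(* Main.v *)
(* The kernel I of f is generated by a central idempotent 1 - e: splitting the
   left module S off R gives e with f e = 1 and I e = 0, splitting the right
   module gives e' with f e' = 1 and e' I = 0, whence e = e' is central and
   R = S x R'.  Therefore M |-> eM ([corner]) is an exact functor from R-modules
   to S-modules, and G (x)_R S is isomorphic to G.  Both [corner] and restriction
   along f preserve n-presented modules and modules of finite flat dimension.
   Lifting U -> eU -> U to free resolutions exhibits Tor^S(U, eF) as a natural
   retract of Tor^R(U, F) if U is an S-module and F an R-module, and Tor^R(U, F)
   as a natural retract of Tor^S(eU, F) if U is an R-module and F an S-module.
   Retracts inherit vanishing and exactness, so corner and restriction carry the
   sequences witnessing Gorenstein flatness back and forth. *)
From HB Require Import structures.
Require Import Defs.
From mathcomp Require Import all_boot all_algebra.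
From mathcomp.classical Require Import boolp.
From mathcomp.multinomials Require Import freeg.
Set Implicit Arguments.
Unset Strict Implicit.
Unset Printing Implicit Defensive.
Import GRing.Theory.
Local Open Scope ring_scope.

Definition to_linear (T : nzRingType) (U V : lmodType T) (g : U -> V)
    (gL : linear g) : {linear U -> V} :=
  HB.pack g (GRing.isLinear.Build T U V *:%R g gL).

(** * Central idempotent splittings *)

(** Encodes A as the product of the rings eA and (1 - e)A, with f the projection onto the factor eA,
    identified with B. *)
Record splitting (A B : nzRingType) (f : {rmorphism A -> B}) := Splitting {
  split_idem : A;
  split_surj : surj f;
  split_idem1 : f split_idem = 1;
  split_idemC : forall a, a * split_idem = split_idem * a;
  split_ker : forall a, f a = 0 -> a * split_idem = 0 }.

Section Corner.
Variables (A B : nzRingType) (f : {rmorphism A -> B}) (c : splitting f).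
Local Notation e := (split_idem c).

Lemma split_idemK : e * e = e.
Proof.
apply/eqP; rewrite -subr_eq0 -{3}[e]mul1r -mulrBl; apply/eqP.
by apply: split_ker; rewrite rmorphB rmorph1 split_idem1 subrr.
Qed.

(** A mere set-theoretic section, neither additive nor multiplicative; by [split_eq] the choice of
    lift is invisible after multiplication by e. *)
Definition split_lift (b : B) : A := sval (cid (split_surj c b)).

Lemma split_liftK b : f (split_lift b) = b.
Proof. exact: svalP (cid (split_surj c b)). Qed.

Lemma split_eq a a' : f a = f a' -> a * e = a' * e.
Proof.
move=> faa; apply/eqP; rewrite -subr_eq0 -mulrBl; apply/eqP.
by apply: split_ker; rewrite rmorphB faa subrr.
Qed.

Lemma split_idem_restrict (V : lmodType B) (x : restrict f V) : e *: x = x.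
Proof. by rewrite /GRing.scale /= /restrict_scale split_idem1 scale1r. Qed.

Section CornerModule.
Variable V : lmodType A.

(** Since e is idempotent, its fixed points form the image eV. *)
Definition in_corner : pred V := fun x => e *: x == x.

Record corner_of := Corner { corner_val : V; _ : in_corner corner_val }.

HB.instance Definition _ := [isSub for corner_val].
HB.instance Definition _ := [Choice of corner_of by <:].

Lemma in_corner_closed : zmod_closed in_corner.
Proof.
split=> [|x y /eqP xe /eqP ye]; apply/eqP; first exact: scaler0.
by rewrite scalerBr xe ye.
Qed.

HB.instance Definition _ :=
  GRing.SubChoice_isSubZmodule.Build V in_corner corner_of in_corner_closed.

Lemma cornerP (x : corner_of) : e *: val x = val x.
Proof. exact/eqP/(valP x). Qed.

Lemma in_corner_scale a (x : corner_of) : in_corner (a *: val x).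
Proof. by rewrite /in_corner scalerA -split_idemC -scalerA cornerP. Qed.

(** B acts through arbitrary lifts to A; this is well defined because the kernel of f kills eV. *)
Definition corner_scale (b : B) (x : corner_of) : corner_of :=
  Corner (in_corner_scale (split_lift b) x).

Lemma split_scale_eq a a' (x : corner_of) :
  f a = f a' -> a *: val x = a' *: val x.
Proof. by move/split_eq=> aa; rewrite -cornerP !scalerA aa. Qed.

Lemma corner_scaleE a b (x : corner_of) :
  f a = b -> val (corner_scale b x) = a *: val x.
Proof. by move=> ab; apply: split_scale_eq; rewrite split_liftK. Qed.

Lemma corner_scaleA a b v : corner_scale a (corner_scale b v) = corner_scale (a * b) v.
Proof.
apply: val_inj; rewrite /= scalerA; apply: split_scale_eq.
by rewrite rmorphM !split_liftK.
Qed.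

Lemma corner_scale1 : left_id 1 corner_scale.
Proof.
by move=> v; apply: val_inj; rewrite (@corner_scaleE 1) ?scale1r ?rmorph1.
Qed.

Lemma corner_scaleDr : right_distributive corner_scale +%R.
Proof. by move=> a u v; apply: val_inj; rewrite raddfD /= scalerDr. Qed.

Lemma corner_scaleDl v : {morph corner_scale^~ v : a b / a + b}.
Proof.
move=> a b; apply: val_inj; rewrite raddfD /= -scalerDl.
by apply: corner_scaleE; rewrite rmorphD !split_liftK.
Qed.

HB.instance Definition _ :=
  GRing.Zmodule_isLmodule.Build B corner_of
    corner_scaleA corner_scale1 corner_scaleDr corner_scaleDl.

Definition corner : lmodType B := corner_of.

Lemma scale_cornerE a (x : corner) : val (f a *: x) = a *: val x.
Proof. exact: corner_scaleE. Qed.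

Lemma corner_proj_subproof (x : V) : in_corner (e *: x).
Proof. by rewrite /in_corner scalerA split_idemK. Qed.

Lemma corner_proj_is_linear :
  linear (fun x => Corner (corner_proj_subproof x) : restrict f corner).
Proof.
move=> a x y; apply: val_inj.
rewrite [RHS](raddfD (val : corner -> V)) [X in _ = X + _]scale_cornerE /=.
by rewrite scalerDr !scalerA split_idemC.
Qed.

Definition corner_proj : {linear V -> restrict f corner} :=
  to_linear corner_proj_is_linear.

Lemma corner_incl_is_linear : linear (fun x : restrict f corner => val (x : corner)).
Proof.
move=> a x y; rewrite [LHS](raddfD (val : corner -> V)).
by rewrite [X in X + _ = _]scale_cornerE.
Qed.

Definition corner_incl : {linear restrict f corner -> V} :=
  to_linear corner_incl_is_linear.

Lemma corner_inclK x : corner_proj (corner_incl x) = x.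
Proof. exact/val_inj/cornerP. Qed.

Lemma corner_projK x : corner_incl (corner_proj x) = e *: x.
Proof. by []. Qed.

End CornerModule.

Lemma restrict_map_is_linear (V W : lmodType B) (g : {linear V -> W}) :
  linear (g : restrict f V -> restrict f W).
Proof. by move=> a x y; exact: (linearP g (f a) x y). Qed.

Definition restrict_map (V W : lmodType B) (g : {linear V -> W}) :
    {linear restrict f V -> restrict f W} :=
  to_linear (restrict_map_is_linear g).

(** Every scalar of B comes from A, so restriction along f is a full functor. *)
Lemma unrestrict_is_linear (V W : lmodType B)
  (g : {linear restrict f V -> restrict f W}) : linear (g : V -> W).
Proof.
move=> b x y; have [a <-] := split_surj c b.
exact: (linearP g a x y).
Qed.

Definition unrestrict (V W : lmodType B)
    (g : {linear restrict f V -> restrict f W}) : {linear V -> W} :=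
  to_linear (unrestrict_is_linear g).

(** Projecting back with e lands in the corner by construction; [corner_mapE] shows that this
    projection changes nothing. *)
Definition corner_map (V W : lmodType A) (g : {linear V -> W}) :
    {linear corner V -> corner W} :=
  unrestrict (corner_proj W \o (g \o corner_incl V)).

Lemma corner_mapE (V W : lmodType A) (g : {linear V -> W}) x :
  val (corner_map g x) = g (val x).
Proof. by rewrite /= -linearZ cornerP. Qed.

Lemma corner_map_proj (V W : lmodType A) (g : {linear V -> W}) x :
  corner_map g (corner_proj V x) = corner_proj W (g x).
Proof. by apply: val_inj; rewrite corner_mapE /= linearZ. Qed.

Lemma corner_map_surj (V W : lmodType A) (g : {linear V -> W}) :
  surj g -> surj (corner_map g).
Proof.
move=> gS y; have [x gx] := gS (val y); exists (corner_proj V x).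
by rewrite corner_map_proj gx; apply: corner_inclK.
Qed.

Lemma corner_map_exact (V W X : lmodType A) (g : {linear V -> W})
    (h : {linear W -> X}) : exact g h -> exact (corner_map g) (corner_map h).
Proof.
move=> gh y; split=> [/(congr1 val)|[x <-]].
  rewrite corner_mapE => /gh[x gx]; exists (corner_proj V x).
  by rewrite corner_map_proj gx; apply: corner_inclK.
apply: val_inj; rewrite !corner_mapE; apply/gh.
by exists (val x).
Qed.

End Corner.

Lemma conv_splitting_subproof (A B : nzRingType) (f : {rmorphism A -> B})
    (c : splitting f) (a : op A) :
  a * (split_idem c : op A) = (split_idem c : op A) * a.
Proof. exact: (esym (split_idemC c a)). Qed.

Lemma conv_splitting_ker (A B : nzRingType) (f : {rmorphism A -> B})
    (c : splitting f) (a : op A) :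
  conv f a = 0 -> a * (split_idem c : op A) = 0.
Proof. by move=> a0; rewrite conv_splitting_subproof; apply: (split_ker c). Qed.

(** A central idempotent serves both sides, so the corner construction also applies to right
    modules. *)
Definition conv_splitting (A B : nzRingType) (f : {rmorphism A -> B})
    (c : splitting f) : splitting (conv f) :=
  @Splitting (op A) (op B) (conv f) (split_idem c) (split_surj c)
    (split_idem1 c) (conv_splitting_subproof c) (@conv_splitting_ker _ _ f c).

(* If B is projective, a section B -> A of f sends 1 to a lift e of 1 that ker f
   annihilates. *)
Lemma projective_idem (A B : nzRingType) (f : {rmorphism A -> B}) :
    surj f -> projective (restrict f B^o) ->
  exists e, f e = 1 /\ forall a, f a = 0 -> a * e = 0.
Proof.
move=> fS fP.
have fL : linear (f : A^o -> restrict f B^o).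
  by move=> a x y; rewrite rmorphD rmorphM.
have [k kK] := fP _ _ (to_linear fL) idfun fS.
exists (k (1 : B^o)); split=> [|a fa0]; first exact: (kK (1 : B^o)).
apply: etrans (esym (linearZ_LR k a (1 : B^o))) _.
have -> : (a *: ((1 : B^o) : restrict f B^o)) = 0.
  by rewrite /GRing.scale /= /restrict_scale fa0 scale0r.
exact: raddf0.
Qed.

Lemma projective_splitting (A B : nzRingType) (f : {rmorphism A -> B}) :
    surj f -> projective (restrict f B^o) ->
    projective (restrict (conv f) (op B)^o) ->
  inhabited (splitting f).
Proof.
move=> fS fPl fPr.
have [e [fe Ie]] := projective_idem fS fPl.
have [e' [fe' Ie']] := @projective_idem _ _ (conv f) fS fPr.
rewrite /op in e' fe' Ie'; pose e2 : A := e'.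
have fe2 : f e2 = 1 := fe'.
(* Products are reversed in the converse ring, so the right-hand idempotent annihilates the kernel
   from the left. *)
have e2I a : f a = 0 -> e2 * a = 0 := Ie' a.
(* Both 1 - e and 1 - e2 lie in the kernel, whence e = e2 e = e2. *)
have ee2 : e = e2.
  have /eqP : (1 - e2) * e = 0 by apply: Ie; rewrite rmorphB rmorph1 fe2 subrr.
  have /eqP : e2 * (1 - e) = 0 by apply: e2I; rewrite rmorphB rmorph1 fe subrr.
  rewrite mulrBl mulrBr mul1r mulr1 !subr_eq0 => /eqP e2e /eqP ee.
  exact: etrans ee (esym e2e).
rewrite -{}ee2 in e2I.
(* Centrality: a(1 - e) and (1 - e)a lie in the kernel, so ea = eae = ae. *)
have ker1 a : f (a * (1 - e)) = 0 by rewrite rmorphM rmorphB rmorph1 fe subrr mulr0.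
have ker2 a : f ((1 - e) * a) = 0 by rewrite rmorphM rmorphB rmorph1 fe subrr mul0r.
split; apply: (@Splitting _ _ f e) => // a.
have /eqP := Ie _ (ker2 a); have /eqP := e2I _ (ker1 a).
rewrite !(mulrBl, mulrBr, mul1r, mulr1, mulrA) !subr_eq0 => /eqP ea /eqP ae.
exact: etrans ae (esym ea).
Qed.

(** * Comparison of resolutions *)

(** Used to build chain maps and homotopies degree by degree: [I] records what makes the next degree
    constructible, [E] ties consecutive degrees together. *)
Lemma dependent_choice_inv (X : nat -> Type) (I : forall k, X k -> Prop)
    (E : forall k, X k -> X k.+1 -> Prop) (x0 : X 0) :
    I 0 x0 ->
    (forall k x, I k x -> exists y, I k.+1 y /\ E k x y) ->
  exists s : forall k, X k, s 0 = x0 /\ forall k, E k (s k) (s k.+1).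
Proof.
move=> Ix0 step.
pose next k (x : {x : X k | I k x}) :=
  cid (step k (sval x) (svalP x)).
pose s := nat_rect (fun k => {x : X k | I k x}) (exist _ x0 Ix0)
  (fun k x => exist _ (sval (next k x)) (proj1 (svalP (next k x)))).
exists (fun k => sval (s k)); split=> // k.
exact: proj2 (svalP (next k (s k))).
Qed.

(* Lifting along g only requires that h lands in the image of g pointwise, which
   spares us the construction of image modules. *)
Definition liftable (T : nzRingType) (P : lmodType T) : Prop :=
  forall (A B : lmodType T) (g : {linear A -> B}) (h : {linear P -> B}),
    (forall x, exists y, g y = h x) ->
  exists k : {linear P -> A}, forall x, g (k x) = h x.

Section FreeLift.
Variables (T : nzRingType) (X : choiceType) (V : lmodType T) (b : X -> V).

Definition free_lift : {freeg X / T} -> V := fglift b.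

Lemma free_lift_is_zmod_morphism : zmod_morphism free_lift.
Proof. exact: lift_is_additive. Qed.

HB.instance Definition _ :=
  GRing.isZmodMorphism.Build {freeg X / T} V free_lift free_lift_is_zmod_morphism.

Lemma free_lift1 c x : free_lift << c *g x >> = c *: b x.
Proof. exact: liftU. Qed.

Lemma scale_freegU (c k : T) (x : X) :
  c *: << k *g x >> = << c * k *g x >> :> {freeg X / T}.
Proof. by apply/eqP/freeg_eqP => z; rewrite coeffZ !coeffU mulrA. Qed.

Lemma free_lift_is_scalable : scalable free_lift.
Proof.
move=> c; elim/freeg_ind_dom0 => [|k x D _ _ IH].
  by rewrite scaler0 raddf0 scaler0.
by rewrite scalerDr scale_freegU !raddfD /= IH !free_lift1 scalerA.
Qed.

HB.instance Definition _ :=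
  GRing.isScalable.Build T {freeg X / T} V *:%R free_lift free_lift_is_scalable.
End FreeLift.

Lemma free_liftable (T : nzRingType) (X : choiceType) :
  liftable ({freeg X / T} : lmodType T).
Proof.
move=> A B g h gh.
have [b bh] := choice (fun x : X => gh << x >>).
exists (free_lift b) => x.
elim/freeg_ind_dom0: x => [|k x D _ _ IH]; first by rewrite !raddf0.
rewrite !raddfD; apply: (congr2 +%R) => /=; last exact: IH.
by rewrite free_lift1 linearZ bh -linearZ scale_freegU mulr1.
Qed.

(** Restriction is left adjoint to the exact functor [corner], so a lifting problem over A is solved
    on the corners, over B. *)
Lemma restrict_liftable (A B : nzRingType) (f : {rmorphism A -> B})
  (c : splitting f) (P : lmodType B) : liftable P -> liftable (restrict f P).
Proof.
move=> Pl V W g h gh.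
pose h' : {linear P -> corner c W} := unrestrict c (corner_proj c W \o h).
have [|k kK] := Pl _ _ (corner_map c g) h'.
  move=> x; have [y gy] := gh x; exists (corner_proj c V y).
  by rewrite corner_map_proj gy.
exists (corner_incl c V \o restrict_map f k) => x.
have := congr1 val (kK x); rewrite corner_mapE => /= ->.
by rewrite -linearZ split_idem_restrict.
Qed.

Section Comparison.
Variables (T : nzRingType) (U V : lmodType T) (P : augmented U) (Q : augmented V).
Hypothesis P_proj : forall k, liftable (P k).
Hypothesis augK : forall x, aug P (abd P 0 x) = 0.
Hypothesis abdK : forall k x, abd P k (abd P k.+1 x) = 0.
Hypothesis Q_surj : surj (aug Q).
Hypothesis Q_exact : forall k, exact_at Q k.

Lemma comparison_lift (phi : {linear U -> V}) :
  exists h : forall k, {linear P k -> Q k},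
    (forall x, aug Q (h 0 x) = phi (aug P x)) /\
    (forall k x, abd Q k (h k.+1 x) = h k (abd P k x)).
Proof.
have [h0 h0E] := @P_proj 0 _ _ (aug Q) (phi \o aug P) (fun x => Q_surj _).
have h0I x : exists y, abd Q 0 y = h0 (abd P 0 x).
  by apply/(Q_exact 0); rewrite h0E /= augK raddf0.
(* The invariant says that h d lands in the image of the next differential of Q, which is what
   [liftable] asks for. *)
have [k h hI|h [h00 hE]] :=
  @dependent_choice_inv (fun k => {linear P k -> Q k})
    (fun k h => forall x, exists y, abd Q k y = h (abd P k x))
    (fun k h h' => forall x, abd Q k (h' x) = h (abd P k x)) h0 h0I.
  have [h' h'E] := @P_proj k.+1 _ _ (abd Q k) (h \o abd P k) hI.
  exists h'; split=> // x; apply/(Q_exact k.+1).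
  by rewrite h'E /= abdK raddf0.
by exists h; split=> // x; rewrite h00 h0E.
Qed.

(** Meant for the difference of two lifts of the same map, which is a lift of zero. *)
Lemma comparison_homotopy (h : forall k, {linear P k -> Q k}) :
    (forall x, aug Q (h 0 x) = 0) ->
    (forall k x, abd Q k (h k.+1 x) = h k (abd P k x)) ->
  exists s : forall k, {linear P k -> Q k.+1},
    (forall x, h 0 x = abd Q 0 (s 0 x)) /\
    (forall k x, h k.+1 x = abd Q k.+1 (s k.+1 x) + s k (abd P k x)).
Proof.
move=> h0 hE.
have [x|s0 s0E] := @P_proj 0 _ _ (abd Q 0) (h 0).
  by apply/(Q_exact 0); rewrite h0.
(* The difference takes values in cycles, because d s0 d = h0 d = d h1; exactness of Q turns them
   into boundaries. *)
have s0I x : exists y, abd Q 1 y = h 1 x - s0 (abd P 0 x).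
  by apply/(Q_exact 1); rewrite linearB (hE 0) s0E subrr.
have [k s sI|s [s00 sE]] :=
  @dependent_choice_inv (fun k => {linear P k -> Q k.+1})
    (fun k s => forall x, exists y, abd Q k.+1 y = h k.+1 x - s (abd P k x))
    (fun k s s' => forall x, abd Q k.+1 (s' x) = h k.+1 x - s (abd P k x)) s0 s0I.
  have [s' s'E] := @P_proj k.+1 _ _ (abd Q k.+1) (h k.+1 \- (s \o abd P k)) sI.
  exists s'; split=> // x; apply/(Q_exact k.+2).
  by rewrite linearB hE s'E /= abdK raddf0 subr0 subrr.
exists s; split=> [x|k x]; first by rewrite s00 s0E.
by rewrite sE subrK.
Qed.
End Comparison.

Section FreeResolution.
Variables (T : nzRingType) (U : lmodType T).

Lemma free_eval_surj (V : lmodType T) : surj (@free_eval T V).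
Proof. by move=> x; exists << x >>; rewrite free_eval1 scale1r. Qed.

Lemma free_res_liftable k : liftable (free_res U k).
Proof. exact: free_liftable. Qed.

Lemma free_res_exact k : exact_at (free_res U) k.
Proof.
have ex V : exact (syzygy_incl V \o @free_eval T (syzygy V)) (@free_eval T V).
  move=> y; split=> [/eqP y0|[x <-]]; last exact/eqP/(valP (free_eval x)).
  have [x xy] := @free_eval_surj (syzygy V) (Syzygy y0).
  by exists x; rewrite /= xy.
case: k => [|k] y; first exact: ex.
(* The differential is evaluation followed by an injection, so its kernel is that of the
   evaluation. *)
rewrite -(ex (syz U k.+1)); split=> [y0|/= ->]; first exact: val_inj.
exact: (raddf0 (syzygy_incl (syz U k))).
Qed.

Lemma free_res_augK x : aug (free_res U) (abd (free_res U) 0 x) = 0.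
Proof. by apply/(@free_res_exact 0); exists x. Qed.

End FreeResolution.

(** * Comparison of Tor groups *)

Lemma homology_map_pi (C D : chain_complex) (h : chain_map C D) k z :
  homology_map h k (quo_pi (@is_boundary C k) z) =
  quo_pi (@is_boundary D k) (cycles_map h z).
Proof. exact: (quo_lift_pi (@cycles_class_boundary C D h k)). Qed.

(** The homotopy condition is tested on cycles only, where the term s d vanishes. *)
Lemma homology_map_cancel (C D : chain_complex) (h : chain_map C D)
    (g : chain_map D C) k :
    (forall z : cycles C k, exists y, bd C k y = g k (h k (val z)) - val z) ->
  cancel (homology_map h k) (homology_map g k).
Proof.
move=> gh x; rewrite -[x]quo_reprK !homology_map_pi.
apply/quo_piP; apply: span_in; have [y yE] := gh (quo_repr x); exists y.
by rewrite yE raddfB.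
Qed.

Lemma homology_map_square (C D C' D' : chain_complex) (h1 : chain_map C D)
    (h2 : chain_map D D') (h3 : chain_map C C') (h4 : chain_map C' D') k :
    (forall x, h2 k (h1 k x) = h4 k (h3 k x)) ->
  forall x, homology_map h2 k (homology_map h1 k x) =
            homology_map h4 k (homology_map h3 k x).
Proof.
move=> hE x; rewrite -[x]quo_reprK !homology_map_pi; congr (quo_pi _ _).
exact/val_inj/hE.
Qed.

(** Diagram chase: an element y killed by [g'] goes up by [i2], acquires a preimage there, and [p1]
    brings that preimage down. *)
Lemma exact_retract (A1 A2 A3 B1 B2 B3 : zmodType)
    (f : {additive A1 -> A2}) (g : {additive A2 -> A3})
    (f' : {additive B1 -> B2}) (g' : {additive B2 -> B3})
    (i1 : {additive B1 -> A1}) (i2 : {additive B2 -> A2}) (i3 : {additive B3 -> A3})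
    (p1 : {additive A1 -> B1}) (p2 : {additive A2 -> B2}) (p3 : {additive A3 -> B3}) :
    cancel i2 p2 -> cancel i3 p3 ->
    (forall x, i2 (f' x) = f (i1 x)) -> (forall x, i3 (g' x) = g (i2 x)) ->
    (forall x, p2 (f x) = f' (p1 x)) ->
  exact f g -> exact f' g'.
Proof.
move=> i2K i3K fi gi pf fg y; split=> [y0|[x <-]].
  have [|x xE] := (fg (i2 y)).1; first by rewrite -gi y0 raddf0.
  by exists (p1 x); rewrite -pf xE i2K.
apply: (can_inj i3K); rewrite raddf0 gi fi; apply/fg.
by exists (i1 x).
Qed.

Section SemilinearTensor.
Variables (R S : nzRingType) (f : {rmorphism R -> S}).
Variables (M : lmodType (op R)) (U : lmodType R).
Variables (M' : lmodType (op S)) (U' : lmodType S).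

Section Up.
Variables (a : {linear M -> restrict (conv f) M'}) (b : {linear U -> restrict f U'}).

Lemma tens_up_balanced : balanced (fun m u => pure (a m : M') (b u : U')).
Proof.
have [pDl pDr pZ] := pure_balanced M' U'.
split=> [m m' u|m u u'|t m u]; rewrite ?raddfD ?linearZ; [exact: pDl|exact: pDr|].
exact: (pZ (f t)).
Qed.

Definition tens_up : {additive tens M U -> tens M' U'} := tens_lift tens_up_balanced.

Lemma tens_up_pure m u : tens_up (pure m u) = pure (a m : M') (b u : U').
Proof. exact: tens_lift_pure. Qed.
End Up.

Section Down.
Hypothesis f_surj : surj f.
Variables (a : {linear restrict (conv f) M' -> M}) (b : {linear restrict f U' -> U}).

(** Each scalar of S is f r, so a relation over S is already one over R. *)
Lemma tens_down_balanced :
  balanced (fun (m : M') (u : U') => pure (a m) (b u)).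
Proof.
have [pDl pDr pZ] := pure_balanced M U.
split=> [m m' u|m u u'|t m u].
- by rewrite -pDl -raddfD.
- by rewrite -pDr -raddfD.
have [r <-] := f_surj t.
apply: etrans (etrans (pZ r (a m) (b u)) _).
  by rewrite -linearZ.
by rewrite -linearZ.
Qed.

Definition tens_down : {additive tens M' U' -> tens M U} :=
  tens_lift tens_down_balanced.

Lemma tens_down_pure (m : M') (u : U') : tens_down (pure m u) = pure (a m) (b u).
Proof. exact: tens_lift_pure. Qed.
End Down.
End SemilinearTensor.
Arguments tens_up : simpl never.
Arguments tens_down : simpl never.

(** Takes bare functions with additivity as a premise, so that composites and sums can be compared
    on pure tensors directly. *)
Lemma tens_eq (T : nzRingType) (M : lmodType (op T)) (U : lmodType T)
    (A : zmodType) (g h : tens M U -> A) :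
  zmod_morphism g -> zmod_morphism h ->
  (forall m u, g (pure m u) = h (pure m u)) -> g =1 h.
Proof.
move=> gB hB gh; apply: tens_ind => [|//|x y gx gy]; last by rewrite gB hB gx gy.
by rewrite -(subrr 0) gB hB !subrr.
Qed.

Lemma tens_bd_pure (T : nzRingType) (U : lmodType T) (M : lmodType (op T)) k m u :
  bd (tens_complex U M) k (pure m u) = pure m (abd (free_res U) k u).
Proof. exact: tens_map_pure. Qed.

Lemma tens_chain_pure (T : nzRingType) (U : lmodType T) (M M' : lmodType (op T))
    (phi : {linear M -> M'}) k m u :
  ChainMap (@tens_chain_funP T U M M' phi) k (pure m u) = pure (phi m) u.
Proof. exact: tens_map_pure. Qed.

Lemma tens_homotopy (T : nzRingType) (U : lmodType T) (M : lmodType (op T))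
    (h : forall k, {linear free_res U k -> free_res U k}) :
    (forall x, aug (free_res U) (h 0 x) = 0) ->
    (forall k x, abd (free_res U) k (h k.+1 x) = h k (abd (free_res U) k x)) ->
  forall k (z : cycles (tens_complex U M) k),
  exists y, bd (tens_complex U M) k y = tens_map idfun (h k) (val z).
Proof.
move=> h0 hE.
have [s [s0 sE]] := comparison_homotopy (@free_res_liftable T U)
  (@free_resK T U) (@free_res_exact T U) h0 hE.
case=> [|k] z.
  exists (tens_map idfun (s 0) (val z)).
  move: (val z); apply: tens_eq; try exact: raddfB.
    by move=> x y; rewrite !raddfB.
  by move=> m u; rewrite !tens_map_pure s0.
exists (tens_map idfun (s k.+1) (val z)).
have /eqP dz := valP z.
(* The added zero is s applied to the vanishing boundary of z; the goal becomes the full homotopy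
   identity, which can be checked on pure tensors. *)
rewrite -[LHS]addr0 -(raddf0 (tens_map idfun (s k))) -dz.
move: (val z); apply: tens_eq; try exact: raddfB.
  by move=> x y; rewrite !raddfB opprD addrACA.
move=> m u; rewrite !tens_map_pure sE.
exact/esym/(balancedDr (pure_balanced _ _)).
Qed.

Section TorComparison.
Variables (R S : nzRingType) (f : {rmorphism R -> S}) (c : splitting f).

Definition restrict_aug (V : lmodType S) (P : augmented V) : augmented (restrict f V) :=
  @Augmented R (restrict f V) (fun k => restrict f (P k))
    (fun k => restrict_map f (abd P k)) (restrict_map f (aug P)).

Lemma restrict_aug_exact (V : lmodType S) (P : augmented V) k :
  exact_at P k -> exact_at (restrict_aug P) k.
Proof. by case: k. Qed.

Variables (U : lmodType R) (U' : lmodType S).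
Local Notation P := (free_res U).
Local Notation Q := (free_res U').
Local Notation QR := (restrict_aug Q).

Lemma lift_up (phi : {linear U -> restrict f U'}) :
  exists h : forall k, {linear P k -> restrict f (Q k)},
    (forall x, aug QR (h 0 x) = phi (aug P x)) /\
    (forall k x, abd QR k (h k.+1 x) = h k (abd P k x)).
Proof.
apply: (@comparison_lift _ _ _ P QR).
- exact: free_res_liftable.
- exact: free_res_augK.
- exact: free_resK.
- exact: (@free_eval_surj S U').
- by move=> k; apply: restrict_aug_exact; apply: free_res_exact.
Qed.

(** Free S-modules need not be free over R, but the splitting keeps them liftable, which suffices
    for comparison. *)
Lemma lift_down (phi : {linear restrict f U' -> U}) :
  exists h : forall k, {linear restrict f (Q k) -> P k},
    (forall x, aug P (h 0 x) = phi (aug QR x)) /\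
    (forall k x, abd P k (h k.+1 x) = h k (abd QR k x)).
Proof.
apply: (@comparison_lift _ _ _ QR P).
- by move=> k; apply: (restrict_liftable c); exact: free_res_liftable.
- exact: (@free_res_augK S U').
- exact: (@free_resK S U').
- exact: free_eval_surj.
- exact: free_res_exact.
Qed.

Section ChainMaps.
Variables (M : lmodType (op R)) (M' : lmodType (op S)).

Lemma up_chain_subproof (h : forall k, {linear P k -> restrict f (Q k)})
    (hE : forall k x, abd QR k (h k.+1 x) = h k (abd P k x))
    (a : {linear M -> restrict (conv f) M'}) k x :
  bd (tens_complex U' M') k (tens_up a (h k.+1) x) =
  tens_up a (h k) (bd (tens_complex U M) k x).
Proof.
move: x; apply: tens_eq; try by move=> x y; rewrite !raddfB.
move=> m u; rewrite tens_up_pure !tens_bd_pure tens_up_pure.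
by rewrite -hE.
Qed.

Definition up_chain h hE a : chain_map (tens_complex U M) (tens_complex U' M') :=
  @ChainMap (tens_complex U M) (tens_complex U' M')
    (fun k => tens_up a (h k)) (@up_chain_subproof h hE a).

Lemma down_chain_subproof (h : forall k, {linear restrict f (Q k) -> P k})
    (hE : forall k x, abd P k (h k.+1 x) = h k (abd QR k x))
    (a : {linear restrict (conv f) M' -> M}) k x :
  bd (tens_complex U M) k (tens_down (split_surj c) a (h k.+1) x) =
  tens_down (split_surj c) a (h k) (bd (tens_complex U' M') k x).
Proof.
move: x; apply: tens_eq; try by move=> x y; rewrite !raddfB.
move=> m u; rewrite tens_down_pure !tens_bd_pure tens_down_pure.
by rewrite hE.
Qed.

Definition down_chain h hE a : chain_map (tens_complex U' M') (tens_complex U M) :=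
  @ChainMap (tens_complex U' M') (tens_complex U M)
    (fun k => tens_down (split_surj c) a (h k)) (@down_chain_subproof h hE a).

Lemma up_chain_pure h hE a k m u :
  @up_chain h hE a k (pure m u) = pure (a m : M') (h k u : Q k).
Proof. exact: tens_up_pure. Qed.

Lemma down_chain_pure h hE a k m u :
  @down_chain h hE a k (pure m u) = pure (a m) (h k u).
Proof. exact: tens_down_pure. Qed.
End ChainMaps.

End TorComparison.

Lemma pureBr (T : nzRingType) (M : lmodType (op T)) (U : lmodType T) (m : M) (u v : U) :
  pure m (u - v) = pure m u - pure m v.
Proof.
by apply/eqP; rewrite eq_sym subr_eq -(balancedDr (pure_balanced M U)) subrK.
Qed.

(** * Natural retracts between Tor groups over R and over S *)

Section TorRetracts.
Variables (R S : nzRingType) (f : {rmorphism R -> S}) (c : splitting f).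
Local Notation cc := (conv_splitting c).

Lemma Tor_corner_retract (U' : lmodType S) :
  exists (i : forall (F : lmodType (op R)) k,
            {additive Tor U' (corner cc F) k -> Tor (restrict f U') F k})
         (p : forall (F : lmodType (op R)) k,
            {additive Tor (restrict f U') F k -> Tor U' (corner cc F) k}),
  [/\ forall F k, cancel (i F k) (p F k),
      forall (F G : lmodType (op R)) (phi : {linear F -> G}) k x,
        i G k (Tor_map U' (corner_map cc phi) k x) =
        Tor_map (restrict f U') phi k (i F k x)
    & forall (F G : lmodType (op R)) (phi : {linear F -> G}) k x,
        p G k (Tor_map (restrict f U') phi k x) =
        Tor_map U' (corner_map cc phi) k (p F k x)].
Proof.
have [u [u0 uE]] := @lift_up R S f (restrict f U') U' idfun.
have [v [v0 vE]] := @lift_down R S f c (restrict f U') U' idfun.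
exists (fun F k => homology_map (down_chain c vE (corner_incl cc F)) k).
exists (fun F k => homology_map (up_chain uE (corner_proj cc F)) k).
split=> [F k|F G phi k|F G phi k].
- apply: homology_map_cancel => z.
  (* The composite u v lifts the identity of U', so u v - 1 lifts zero; [unrestrict] makes it
     S-linear, as a homotopy over S requires. *)
  pose h j : {linear free_res U' j -> free_res U' j} := unrestrict c (u j \o v j) \- idfun.
  have [x|j x|y yE] := @tens_homotopy S U' (corner cc F) h _ _ k z.
  + by rewrite linearB; apply/eqP; rewrite subr_eq0; apply/eqP; rewrite -[RHS]v0 -[RHS]u0.
  + by rewrite linearB /=; congr (_ - _); rewrite -vE -uE.
  exists y; rewrite yE; move: (val z); apply: tens_eq => [x t|x t|m q].
  + exact: raddfB.
  + by rewrite !raddfB addrACA.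
  rewrite tens_map_pure tens_down_pure tens_up_pure.
  by rewrite corner_inclK pureBr.
- apply: homology_map_square; apply: tens_eq; try by move=> x t; rewrite !raddfB.
  move=> m q; rewrite down_chain_pure 2!tens_chain_pure down_chain_pure.
  by rewrite -corner_mapE.
- apply: homology_map_square; apply: tens_eq; try by move=> x t; rewrite !raddfB.
  move=> m q; rewrite up_chain_pure 2!tens_chain_pure up_chain_pure.
  by rewrite corner_map_proj.
Qed.

Lemma Tor_restrict_retract (U : lmodType R) :
  exists (i : forall (F : lmodType (op S)) k,
            {additive Tor U (restrict (conv f) F) k -> Tor (corner c U) F k})
         (p : forall (F : lmodType (op S)) k,
            {additive Tor (corner c U) F k -> Tor U (restrict (conv f) F) k}),
  [/\ forall F k, cancel (i F k) (p F k),
      forall (F G : lmodType (op S)) (phi : {linear F -> G}) k x,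
        i G k (Tor_map U (restrict_map (conv f) phi) k x) =
        Tor_map (corner c U) phi k (i F k x)
    & forall (F G : lmodType (op S)) (phi : {linear F -> G}) k x,
        p G k (Tor_map (corner c U) phi k x) =
        Tor_map U (restrict_map (conv f) phi) k (p F k x)].
Proof.
have [u [u0 uE]] := lift_up (corner_proj c U).
have [v [v0 vE]] := lift_down c (corner_incl c U).
exists (fun F k => homology_map (@up_chain _ _ f U _ (restrict (conv f) F) F u uE idfun) k).
exists (fun F k =>
  homology_map (@down_chain _ _ f c U _ (restrict (conv f) F) F v vE idfun) k).
split=> [F k|F G phi k|F G phi k].
- apply: homology_map_cancel => z.
  (* Here v u lifts multiplication by e on U rather than the identity, so it is compared with
     multiplication by e on the resolution. *)
  pose eM j : {linear free_res U j -> free_res U j} := corner_incl c _ \o corner_proj c _.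
  pose h j : {linear free_res U j -> free_res U j} := (v j \o u j) \- eM j.
  have [x|j x|y yE] := @tens_homotopy R U (restrict (conv f) F) h _ _ k z.
  + by rewrite linearB /= v0 u0 linearZ subrr.
  + rewrite [LHS]linearB; congr (_ - _); last exact: linearZ.
    exact: etrans (vE j (u j.+1 x)) (congr1 (v j) (uE j x)).
  exists y; rewrite yE; move: (val z); apply: tens_eq => [x t|x t|m q].
  + exact: raddfB.
  + by rewrite !raddfB addrACA.
  rewrite tens_map_pure up_chain_pure down_chain_pure /= pureBr.
  (* After tensoring, e moves across to the restricted S-module F, where it acts as 1. *)
  congr (_ - _); rewrite -(balancedZ (pure_balanced _ _)).
  by rewrite (split_idem_restrict cc).
- apply: homology_map_square; apply: tens_eq; try by move=> x t; rewrite !raddfB.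
  by move=> m q; rewrite up_chain_pure 2!tens_chain_pure up_chain_pure.
- apply: homology_map_square; apply: tens_eq; try by move=> x t; rewrite !raddfB.
  by move=> m q; rewrite down_chain_pure 2!tens_chain_pure down_chain_pure.
Qed.
End TorRetracts.

(** * Flat dimension and finite presentation *)

Section FlatTransfer.
Variables (R S : nzRingType) (f : {rmorphism R -> S}) (c : splitting f).
Local Notation cc := (conv_splitting c).

Lemma retract_inj (A A' B B' : zmodType) (g : {additive A -> A'})
    (h : {additive B -> B'}) (i : {additive A -> B}) (p : {additive B -> A})
    (i' : {additive A' -> B'}) :
  cancel i p -> (forall x, i' (g x) = h (i x)) -> injective h -> injective g.
Proof. by move=> iK ig hI x y /(congr1 i'); rewrite !ig => /hI/(can_inj iK). Qed.

(** The group M ⊗_R Q is naturally a retract of eM ⊗_S Q, because me ⊗ q = m ⊗ eq = m ⊗ q. *)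
Lemma flat_restrict (Q : lmodType S) : flat Q -> flat (restrict f Q).
Proof.
move=> Qf M M' phi phiI.
pose idQ : {linear restrict f Q -> restrict f Q} := idfun.
have cI : injective (corner_map cc phi).
  by move=> x y /(congr1 val); rewrite !corner_mapE => /phiI/val_inj.
apply: (retract_inj
  (i := tens_up (U' := Q) (corner_proj cc M) idQ)
  (p := tens_down (U' := Q) (split_surj c) (corner_incl cc M) idQ)
  (i' := tens_up (U' := Q) (corner_proj cc M') idQ)
  _ _ (Qf _ _ _ cI)).
  apply: tens_eq => [x y|x y|m q] //; try by rewrite !raddfB.
  rewrite tens_up_pure tens_down_pure corner_projK.
  rewrite (balancedZ (pure_balanced M (restrict f Q)) (split_idem c)).
  by rewrite split_idem_restrict.
apply: tens_eq => [x y|x y|m q] //; try by rewrite !raddfB.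
by rewrite tens_up_pure 2!tens_map_pure tens_up_pure corner_map_proj.
Qed.

(** Dually, M ⊗_S eQ is naturally a retract of M ⊗_R Q through the inclusion of eQ and the
    projection onto it. *)
Lemma flat_corner (Q : lmodType R) : flat Q -> flat (corner c Q).
Proof.
move=> Qf M M' phi phiI.
have rI : injective (restrict_map (conv f) phi) by [].
apply: (retract_inj
  (i := tens_down (split_surj c)
     (idfun : {linear restrict (conv f) M -> restrict (conv f) M}) (corner_incl c Q))
  (p := tens_up (M' := M)
     (idfun : {linear restrict (conv f) M -> restrict (conv f) M}) (corner_proj c Q))
  (i' := tens_down (split_surj c)
     (idfun : {linear restrict (conv f) M' -> restrict (conv f) M'}) (corner_incl c Q))
  _ _ (Qf _ _ _ rI)).
  apply: tens_eq => [x y|x y|m q] //; try by rewrite !raddfB.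
  by rewrite tens_down_pure tens_up_pure corner_inclK.
apply: tens_eq => [x y|x y|m q] //; try by rewrite !raddfB.
by rewrite tens_down_pure 2!tens_map_pure tens_down_pure.
Qed.

Lemma finite_fd_restrict (U : lmodType S) : finite_fd U -> finite_fd (restrict f U).
Proof.
move=> [m [P [Ps Pe Pf P0]]]; exists m, (restrict_aug f P); split=> [|k|k|].
- exact: Ps.
- exact: (restrict_aug_exact f (Pe k)).
- exact: flat_restrict.
- exact: P0.
Qed.

Definition corner_aug (U : lmodType R) (P : augmented U) : augmented (corner c U) :=
  @Augmented S (corner c U) (fun k => corner c (P k))
    (fun k => corner_map c (abd P k)) (corner_map c (aug P)).

Lemma corner_aug_exact (U : lmodType R) (P : augmented U) k :
  exact_at P k -> exact_at (corner_aug P) k.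
Proof. by case: k => [|k] Pk; exact: corner_map_exact Pk. Qed.

Lemma finite_fd_corner (U : lmodType R) : finite_fd U -> finite_fd (corner c U).
Proof.
move=> [m [P [Ps Pe Pf P0]]]; exists m, (corner_aug P); split.
- exact: corner_map_surj.
- by move=> k; apply: (corner_aug_exact (Pe k)).
- by move=> k; apply: flat_corner.
- by move=> k mk x; apply: val_inj; apply: P0.
Qed.

End FlatTransfer.

(** * Finite presentation through iterated kernels *)

Section Kernel.
Variables (T : nzRingType) (V W : lmodType T) (p : {linear V -> W}).

Definition in_kernel : pred V := fun x => p x == 0.

Record kernel_of := Kernel { kernel_val : V; _ : in_kernel kernel_val }.

HB.instance Definition _ := [isSub for kernel_val].
HB.instance Definition _ := [Choice of kernel_of by <:].

Lemma in_kernel_closed : subsemimod_closed in_kernel.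
Proof.
split=> [|a x /eqP x0]; last by apply/eqP; rewrite linearZ /= x0 scaler0.
split=> [|x y /eqP x0 /eqP y0]; apply/eqP; first exact: raddf0.
by rewrite raddfD /= x0 y0 addr0.
Qed.

HB.instance Definition _ :=
  GRing.SubChoice_isSubLmodule.Build T V in_kernel kernel_of in_kernel_closed.

Definition kernel : lmodType T := kernel_of.

Definition kernel_incl : {linear kernel -> V} := val.

Lemma kernel_incl_exact : exact kernel_incl p.
Proof.
by move=> y; split=> [/eqP y0|[x <-]]; [exists (Kernel y0) | exact/eqP/(valP x)].
Qed.

End Kernel.

Lemma corestrict (T : nzRingType) (K F P : lmodType T) (i : {linear K -> F})
    (g : {linear P -> F}) :
    injective i -> (forall x, exists y, i y = g x) ->
  exists h : {linear P -> K}, forall x, i (h x) = g x.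
Proof.
move=> iI gi; have [h hE] := choice gi.
have hL : linear h by move=> a x y; apply: iI; rewrite hE !linearP !hE.
by exists (to_linear hL).
Qed.

Lemma bij_linear_inv (T : nzRingType) (V W : lmodType T) (g : {linear V -> W}) :
  bijective g -> exists h : {linear W -> V}, cancel g h /\ cancel h g.
Proof. by move=> [h gK hK]; exists (to_linear (can2_linear gK hK)). Qed.

(* A free S-module is not free over R, so a presentation cannot be restricted
   term by term; this inductive form of n_presented allows R'-summands to be added
   to the kernels instead. *)
Fixpoint presented (n : nat) (T : nzRingType) (U : lmodType T) : Prop :=
  exists (m : nat) (p : {linear 'rV[T]_m -> U}),
    surj p /\
    if n is k.+1 then
      exists (K : lmodType T) (i : {linear K -> 'rV[T]_m}),
        [/\ injective i, exact i p & presented k K]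
    else True.

(** Dimension shift: dropping P_0 leaves a presentation, one step shorter, of the kernel of the
    augmentation. *)
Lemma n_presented_presented n (T : nzRingType) (U : lmodType T) :
  n_presented n U -> presented n U.
Proof.
elim: n U => [|n IHn] U [P [Ps Pe Pf]].
  have [m [phi /bij_linear_inv[psi [phiK psiK]]]] := Pf 0 isT.
  exists m, (aug P \o psi); split=> // y.
  by have [x <-] := Ps y; exists (phi x); rewrite /= phiK.
have [m [phi /bij_linear_inv[psi [phiK psiK]]]] := Pf 0 isT.
exists m, (aug P \o psi); split=> [y|].
  by have [x <-] := Ps y; exists (phi x); rewrite /= phiK.
exists (kernel (aug P)), (phi \o kernel_incl (aug P)); split.
- by apply: inj_comp; [exact: can_inj phiK | exact: val_inj].
- move=> y; split=> [/(kernel_incl_exact (aug P))[x xE]|[x <-]] /=.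
    by exists x; rewrite -[RHS]psiK -xE.
  by rewrite phiK; apply/(kernel_incl_exact (aug P)); exists x.
(* The first differential, viewed as a map onto the kernel, is the augmentation of the shifted
   sequence. *)
have [||h hE] := @corestrict _ _ _ _ (kernel_incl (aug P)) (abd P 0).
- exact: val_inj.
- move=> x; apply/(kernel_incl_exact (aug P))/(Pe 0) => //.
  by exists x.
apply: IHn; exists (@Augmented T (kernel (aug P)) (fun k => P k.+1)
  (fun k => abd P k.+1) h); split=> [y|[n0 y|k nk]|k nk] /=.
- have [|x xE] := (Pe 0 isT (kernel_incl (aug P) y)).1.
    by apply/(kernel_incl_exact (aug P)); exists y.
  by exists x; apply: val_inj; rewrite -xE -hE.
- rewrite -(Pe 1%N n0 y); split=> [hy|y0]; first by rewrite -hE hy raddf0.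
  by apply: val_inj; rewrite [LHS]hE y0.
- exact: (Pe k.+2).
- exact: Pf.
Qed.

Lemma fg_free_rV (T : nzRingType) m : fg_free ('rV[T]_m : lmodType T).
Proof. by exists m, idfun; exists id. Qed.

Section ConsAugmented.
Variables (T : nzRingType) (U K F : lmodType T) (p : {linear F -> U}).
Variables (i : {linear K -> F}) (P : augmented K).

Definition cons_obj (k : nat) : lmodType T := if k is j.+1 then P j else F.

Definition cons_bd (k : nat) : {linear cons_obj k.+1 -> cons_obj k} :=
  match k return {linear cons_obj k.+1 -> cons_obj k} with
  | 0 => i \o aug P
  | j.+1 => abd P j
  end.

Definition cons_aug : augmented U := @Augmented T U cons_obj cons_bd p.
End ConsAugmented.

Lemma presented_n_presented n (T : nzRingType) (U : lmodType T) :
  presented n U -> n_presented n U.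
Proof.
elim: n U => [|n IHn] U [m [p [ps]]].
  (* Only the surjection from P_0 matters for n = 0; the higher terms and zero maps are
     placeholders. *)
  move=> _; exists (@Augmented T U (fun=> 'rV[T]_m) (fun=> \0) p).
  by split=> // k _; apply: fg_free_rV.
move=> [K [i [iI ip /IHn[P [Ps Pe Pf]]]]]; exists (cons_aug p i P).
split=> [//|[_|[|k] nk]|[_|k nk]] /=.
- move=> y; rewrite -/(exact _ _) ip; split=> [[x <-]|[x <-]]; last by exists (aug P x).
  by have [z <-] := Ps x; exists z.
- move=> y; rewrite -(Pe 0 nk y); split=> [iy|y0].
    exact/iI/(etrans iy)/esym/raddf0.
  exact: etrans (congr1 i y0) (raddf0 i).
- exact: (Pe k.+1).
- exact: fg_free_rV.
- exact: Pf.
Qed.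

(** Free covers and their kernels add up blockwise, with rows of length m1 + m2. *)
Lemma presented_prod n (T : nzRingType) (U V : lmodType T) :
  presented n U -> presented n V -> presented n ((U * V)%type : lmodType T).
Proof.
elim: n U V => [|n IHn] U V [m1 [p1 [s1 e1]]] [m2 [p2 [s2 e2]]].
all: have pL : linear (fun x : 'rV[T]_(m1 + m2) => (p1 (lsubmx x), p2 (rsubmx x)) : U * V)
  by move=> a x y; rewrite !linearP.
all: exists (m1 + m2)%N, (to_linear pL).
all: have ps : surj (to_linear pL)
  by move=> [u v]; have [x <-] := s1 u; have [y <-] := s2 v;
     exists (row_mx x y); rewrite /= row_mxKl row_mxKr.
  by [].
split=> //; have [K1 [i1 [I1 x1 P1]]] := e1; have [K2 [i2 [I2 x2 P2]]] := e2.
have iL : linear (fun k : K1 * K2 => row_mx (i1 k.1) (i2 k.2)).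
  by move=> a x y; rewrite !linearP scale_row_mx add_row_mx.
exists (K1 * K2)%type, (to_linear iL); split; last exact: IHn.
  by move=> [x y] [x' y'] /= /eq_row_mx[/I1-> /I2->].
move=> y; split=> [[/x1[k1 k1E] /x2[k2 k2E]]|[[k1 k2] <-]] /=.
  by exists (k1, k2); rewrite /= k1E k2E hsubmxK.
rewrite row_mxKl row_mxKr; congr (_, _); [apply/x1|apply/x2]; by [exists k1|exists k2].
Qed.

(** * Transfer of finite presentation along f *)

Section PresentedTransfer.
Variables (R S : nzRingType) (f : {rmorphism R -> S}) (c : splitting f).
Local Notation e := (split_idem c).

Section FreeModule.
Variable m : nat.
Local Notation RV := ('rV[R]_m : lmodType R).
Local Notation SV := ('rV[S]_m : lmodType S).

Lemma rV_red_is_linear : linear (map_mx f : RV -> restrict f SV).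
Proof. by move=> a x y; rewrite map_mxD map_mxZ. Qed.

Definition rV_red : {linear RV -> restrict f SV} := to_linear rV_red_is_linear.

(** Entrywise lifting becomes linear once multiplied by e; the section identifies S^m with the
    summand e R^m of R^m. *)
Lemma rV_sec_is_linear :
  linear (fun y : restrict f SV => e *: map_mx (split_lift c) y : RV).
Proof.
move=> a x y; apply/rowP=> j; rewrite !mxE.
rewrite mulrA split_idemC -mulrA -mulrDr -!split_idemC; apply: split_eq.
by rewrite rmorphD rmorphM !split_liftK.
Qed.

Definition rV_sec : {linear restrict f SV -> RV} := to_linear rV_sec_is_linear.

Lemma rV_secK : cancel rV_sec rV_red.
Proof.
move=> y; apply/rowP => j; rewrite !mxE rmorphM split_idem1 mul1r.
exact: split_liftK.
Qed.

Lemma rV_redK x : rV_sec (rV_red x) = e *: x.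
Proof.
apply/rowP => j; rewrite !mxE -!split_idemC; apply: split_eq.
exact: split_liftK.
Qed.

Lemma rV_red_surj : surj rV_red.
Proof. by move=> y; exists (rV_sec y); exact: rV_secK. Qed.

(** R^m is the sum of S^m and K = (1 - e)R^m, so each summand is covered by R^m with the other as
    kernel; the two claims feed each other in the induction. *)
Lemma presented_rV n :
  presented n (restrict f SV) /\ presented n (kernel rV_red).
Proof.
(* The map q is multiplication by 1 - e, regarded as a projection of R^m onto K. *)
have [|x|q qE] := @corestrict _ _ _ _ (kernel_incl rV_red)
    (idfun \- (rV_sec \o rV_red) : {linear RV -> RV}).
- exact: val_inj.
- by apply/kernel_incl_exact; rewrite linearB [X in _ - X]rV_secK subrr.
have {}qE x : kernel_incl rV_red (q x) = x - rV_sec (rV_red x) := qE x.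
have qs : surj q.
  move=> y; exists (val y); apply: val_inj; rewrite [LHS]qE.
  have /kernel_incl_exact/(congr1 rV_sec) : exists x, kernel_incl rV_red x = val y by exists y.
  by rewrite raddf0 => ->; rewrite subr0.
have q0 y : q y = 0 <-> exists x, rV_sec x = y.
  split=> [/(congr1 (kernel_incl rV_red))|[x <-]].
    by rewrite qE raddf0 => /eqP; rewrite subr_eq0 eq_sym => /eqP; exists (rV_red y).
  by apply: val_inj; rewrite [LHS]qE rV_secK subrr.
elim: n => [|n [IH1 IH2]]; split.
- by exists m, rV_red; split=> //; apply: rV_red_surj.
- by exists m, q.
- exists m, rV_red; split; first exact: rV_red_surj.
  exists (kernel rV_red), (kernel_incl rV_red); split=> //; first exact: val_inj.
  exact: kernel_incl_exact.
- exists m, q; split=> //; exists (restrict f SV), rV_sec; split=> //.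
  exact: can_inj rV_secK.
Qed.
End FreeModule.

(** Covering U by R^m through S^m enlarges the kernel K to its sum with (1 - e)R^m, which is
    presented to every order. *)
Lemma presented_restrict n (U : lmodType S) :
  presented n U -> presented n (restrict f U).
Proof.
elim: n U => [|n IHn] U [m [p [ps pE]]].
all: exists m, (restrict_map f p \o rV_red m).
all: have ps' : surj (restrict_map f p \o rV_red m)
  by move=> y; have [x <-] := ps y; have [z <-] := rV_red_surj x; exists z.
  by [].
split=> //; have [K [i [iI ip Kn]]] := pE.
have iL : linear (fun k : restrict f K * kernel (rV_red m) =>
    rV_sec m (restrict_map f i k.1) + kernel_incl (rV_red m) k.2).
  by move=> a x y; rewrite !linearP scalerDr addrACA.
have red_i k : rV_red m (to_linear iL k) = i k.1.
  rewrite linearD rV_secK; rewrite [X in _ + X](_ : _ = 0) ?addr0 //.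
  by apply/kernel_incl_exact; exists k.2.
exists (restrict f K * kernel (rV_red m))%type, (to_linear iL); split.
- move=> k k' kk; have /iI k1 : i k.1 = i k'.1 by rewrite -!red_i kk.
  case: k k' kk k1 => [k1 k2] [k1' k2'] /= kk k1E; rewrite k1E in kk *.
  by move/addrI/val_inj: kk => ->.
- move=> y; split=> [/ip[k kE]|[k <-]]; last first.
    by apply/ip; exists k.1; rewrite red_i.
  have [|z zE] := (kernel_incl_exact (rV_red m) (y - rV_sec m (rV_red m y))).1.
    by rewrite linearB rV_secK subrr.
  (* This is the decomposition y = ey + (1 - e)y. *)
  exists (k, z); apply: etrans (congr2 +%R (congr1 (rV_sec m) kE) zE) _.
  by rewrite addrC subrK.
apply: presented_prod; first exact: IHn.
by have [] := presented_rV m n.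
Qed.

Lemma n_presented_restrict n (U : lmodType S) :
  n_presented n U -> n_presented n (restrict f U).
Proof.
by move/n_presented_presented/presented_restrict/presented_n_presented.
Qed.

(** The corner of R^m is e R^m, which reduction identifies with S^m. *)
Lemma fg_free_corner (V : lmodType R) : fg_free V -> fg_free (corner c V).
Proof.
move=> [m [phi /bij_linear_inv[psi [phiK psiK]]]].
exists m, (unrestrict c (rV_red m \o (phi \o corner_incl c V))).
exists (fun y => corner_proj c V (psi (rV_sec m y))) => [x|y].
  rewrite /= [X in psi X]rV_redK linearZ phiK.
  by apply: val_inj; rewrite /= !cornerP.
change (rV_red m (phi (e *: psi (rV_sec m y))) = y).
rewrite (linearZ_LR phi) psiK (linearZ_LR (rV_red m)) rV_secK.
exact: split_idem_restrict.
Qed.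

Lemma n_presented_corner n (U : lmodType R) :
  n_presented n U -> n_presented n (corner c U).
Proof.
move=> [P [Ps Pe Pf]]; exists (corner_aug c P); split.
- exact: corner_map_surj.
- by move=> k kn; apply: (corner_aug_exact c (Pe k kn)).
- by move=> k kn; apply/fg_free_corner/Pf.
Qed.

End PresentedTransfer.

(** * Gorenstein flatness *)

Section GorensteinTransfer.
Variables (n d : nat) (R S : nzRingType) (f : {rmorphism R -> S}) (c : splitting f).
Local Notation cc := (conv_splitting c).

Lemma nd_flat_corner (F : lmodType (op R)) : nd_flat n d F -> nd_flat n d (corner cc F).
Proof.
move=> Ff U /(n_presented_restrict c) UP x.
have [i [p [iK _ _]]] := Tor_corner_retract c U.
by apply: (can_inj (iK F d.+1)); rewrite raddf0; apply: Ff.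
Qed.

Lemma nd_flat_restrict (F : lmodType (op S)) :
  nd_flat n d F -> nd_flat n d (restrict (conv f) F).
Proof.
move=> Ff U /(n_presented_corner c) UP x.
have [i [p [iK _ _]]] := Tor_restrict_retract c U.
by apply: (can_inj (iK F d.+1)); rewrite raddf0; apply: Ff.
Qed.

(** The sequence is restricted to R while a test module over R is replaced by its corner over S. *)
Lemma gorenstein_flat_restrict (G : lmodType (op S)) :
  gorenstein_flat n d G -> gorenstein_flat n d (restrict (conv f) G).
Proof.
move=> [F [del [Ff Fe [j [jI je]] FT]]].
exists (fun i => restrict (conv f) (F i)), (fun i => restrict_map (conv f) (del i)).
split=> [i|i||U UP Ufd i].
- exact: nd_flat_restrict.
- exact: Fe.
- by exists (restrict_map (conv f) j).
have [a [p [aK aE pE]]] := Tor_restrict_retract c U.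
apply: (exact_retract (aK _ d) (aK _ d) (aE _ _ _ d) (aE _ _ _ d) (pE _ _ _ d)).
by apply: FT; [apply: n_presented_corner | apply: finite_fd_corner].
Qed.

Lemma gorenstein_flat_of_restrict (G : lmodType (op S)) :
  gorenstein_flat n d (restrict (conv f) G) -> gorenstein_flat n d G.
Proof.
move=> [F [del [Ff Fe [j [jI je]] FT]]].
exists (fun i => corner cc (F i)), (fun i => corner_map cc (del i)).
split=> [i|i||U UP Ufd i].
- exact: nd_flat_corner.
- exact: corner_map_exact.
(* As e acts trivially on a restricted S-module, j takes values in the corner and still exhibits G
   as the kernel there. *)
- pose j' : {linear G -> corner cc (F 0)} := unrestrict cc (corner_proj cc (F 0) \o j).
  have j'E x : val (j' x) = j x.
    by rewrite -[in RHS](split_idem_restrict cc x) linearZ.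
  exists j'; split=> [x y /(congr1 val)|y]; first by rewrite !j'E => /jI.
  split=> [/(congr1 val)|[x <-]].
    by rewrite corner_mapE => /je[x xE]; exists x; apply: val_inj; rewrite j'E.
  by apply: val_inj; rewrite corner_mapE j'E; apply/je; exists x.
have [a [p [aK aE pE]]] := Tor_corner_retract c U.
apply: (exact_retract (aK _ d) (aK _ d) (aE _ _ _ d) (aE _ _ _ d) (pE _ _ _ d)).
by apply: FT; [apply: (n_presented_restrict c) | apply: (finite_fd_restrict c)].
Qed.

End GorensteinTransfer.

Lemma gorenstein_flat_iso n d (T : nzRingType) (G H : lmodType (op T))
    (g : {linear H -> G}) :
  bijective g -> gorenstein_flat n d G -> gorenstein_flat n d H.
Proof.
move=> [h gK hK] [F [del [Ff Fe [j [jI je]] FT]]]; exists F, del; split=> //.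
exists (j \o g); split=> [|y]; first by apply: inj_comp => //; apply: can_inj gK.
rewrite je; split=> [[x <-]|[x <-]]; last by exists (g x).
by exists (h x); rewrite /= hK.
Qed.

(** * The isomorphism of G with its restriction extended back to S *)

Section ExtendRestrict.
Variables (R S : nzRingType) (f : {rmorphism R -> S}) (f_surj : surj f).
Variable G : lmodType (op S).
Local Notation G_R := (restrict (conv f) G).

(** Linearity over S uses surjectivity: s = f r moves across the tensor sign as r. *)
Lemma extend_unit_is_linear :
  linear (fun g : G => pure (g : G_R) (1 : left_reg f) : extend f G_R).
Proof.
have [pDl _ pZ] := pure_balanced G_R (left_reg f).
move=> s x y; have [r rs] := f_surj s.
apply: etrans (pDl (s *: x : G) y 1) _; congr (_ + _).
rewrite [RHS]extend_scale_pure -rs.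
apply: etrans (pZ r x 1) _; congr pure.
by rewrite /right_mul mul1r; apply: mulr1.
Qed.

Definition extend_unit : {linear G -> extend f G_R} := to_linear extend_unit_is_linear.

(** The action map g ⊗ s to gs, which provides the inverse of [extend_unit]. *)
Lemma extend_counit_balanced :
  balanced (fun (g : G_R) (x : left_reg f) => (x : op S) *: (g : G)).
Proof.
split=> [m m' u|m u u'|t m u].
- exact: (scalerDr (u : op S)).
- exact: (scalerDl (m : G) (u : op S)).
- exact: (scalerA (u : op S) (f t : op S) (m : G)).
Qed.

Lemma extend_unit_bij : bijective extend_unit.
Proof.
exists (tens_lift extend_counit_balanced) => [x|].
  by rewrite tens_lift_pure; apply: scale1r.
apply: tens_eq => [x y|//|m u]; first by rewrite !raddfB.
rewrite tens_lift_pure linearZ [LHS]extend_scale_pure.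
by rewrite /right_mul mul1r.
Qed.

End ExtendRestrict.

Theorem theorem4p3 (n d : nat) (R S : nzRingType) (f : {rmorphism R -> S})
    (f_surj : surj f)
    (S_proj_right : projective (restrict (conv f) (op S)^o))
    (S_proj_left : projective (restrict f S^o))
    (G : lmodType (op S)) :
  let G_R : lmodType (op R) := restrict (conv f) G in
  (gorenstein_flat n d G_R <-> gorenstein_flat n d (extend f G_R)) /\
  (gorenstein_flat n d (extend f G_R) <-> gorenstein_flat n d G).
Proof.
move=> G_R.
have [c] := projective_splitting f_surj S_proj_left S_proj_right.
have RS : gorenstein_flat n d G_R <-> gorenstein_flat n d G.
  by split; [apply: (gorenstein_flat_of_restrict c) | apply: (gorenstein_flat_restrict c)].
have ES : gorenstein_flat n d (extend f G_R) <-> gorenstein_flat n d G.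
  have [h [uK hK]] := bij_linear_inv (extend_unit_bij f_surj G).
  split; apply: gorenstein_flat_iso; first exact: extend_unit_bij.
  by exists (extend_unit f_surj G); [exact: hK | exact: uK].
by split; rewrite ?RS ES.
Qed.
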